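(* Let $\sigma$ be an irreducible Pisot substitution on $\mathcal A=\{1,\dots,n\}$. Let $h$ send $[\Psi(\mathbf y),a]\in\Psi(Z)\times\mathcal A$ to the $n$-tuple of subsets of $\mathbb R$ with $\{\langle-\mathbf y,\mathbf v_\alpha\rangle\}$ at position $a$ and $\emptyset$ elsewhere; let $v$ send $(x,a)\in X$ to the $n$-tuple of subsets of $\mathbb R$ with $\{x\}$ at position $a$ and $\emptyset$ elsewhere (and likewise $(z,a)\in K_\sigma\times\mathcal A$ to an $n$-tuple of subsets of $K_\sigma$); and let $C=v\circ G\circ(\pi_{\mathbf u}\times\mathrm{id})$, sending $[\mathbf z,a]^*\in\Psi(Z)\times\mathcal A$ to $v\big(G((\pi_{\mathbf u}\times\mathrm{id})(\mathbf z)),a\big)$. All these maps are extended to sets by componentwise unions. Then the following diagrams commute: $$h\circ E_1=\boldsymbol\varTheta\circ h\ \text{ on }\Psi(Z)\times\mathcal A,\qquad v\circ T_\sigma^{-1}=\boldsymbol\varTheta^\#\circ v\ \text{ on }X,\qquad C\circ E_1^*=(\boldsymbol\varTheta^\star)^\#\circ C\ \text{ on }\Psi(Z)\times\mathcal A.$$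
   Context: A substitution on $\mathcal A$ is an endomorphism $\sigma$ of the free monoid $\mathcal A^*$ such that the image of each letter is non-empty and $|\sigma^k(b)|\to\infty$ for at least one letter $b$. $\mathbf P(w)=(|w|_1,\dots,|w|_n)^t$; $M_\sigma$ has entries $(M_\sigma)_{a,b}=|\sigma(b)|_a$. $\sigma$ is an irreducible Pisot substitution if $M_\sigma$ is primitive with characteristic polynomial irreducible over $\mathbb Q$ and its dominant eigenvalue $\alpha$ is a Pisot number (algebraic integer $>1$ all of whose other conjugates have modulus $<1$; not necessarily a unit). The prefix automaton has vertex set $\mathcal A$ and an edge $b\xrightarrow{p}a$ whenever $\sigma(b)=pas$ for some $p,s\in\mathcal A^*$. $K=\mathbb Q(\alpha)$; $S_\alpha$ is the set of primes (places) of $K$ that are infinite or are finite and divide $(\alpha)$; $\mathfrak p_1$ is the infinite prime with $|\alpha|_{\mathfrak p_1}=\alpha$; $K_\sigma=\prod_{\mathfrak p\in S_\alpha\setminus\{\mathfrak p_1\}}K_{\mathfrak p}$; $\Phi':K\to K_\sigma$ is the diagonal embedding; $K$ acts on $K_\sigma$ coordinatewise. $\mathbf v_\alpha=(v_1,\dots,v_n)$ is a left eigenvector of $M_\sigma$ for $\alpha$ with positive entries in $\mathbb Q(\alpha)$; $\delta(w)=\langle\mathbf P(w),\mathbf v_\alpha\rangle$. $X=\bigcup_{a\in\mathcal A}[0,\delta(a))\times\{a\}$ and $T_\sigma^{-1}(x,a)=\bigcup_{b\xrightarrow{p}a}\{(\alpha^{-1}(x+\delta(p)),b)\}$. $Z=\bigcup_{k\ge0}M_\sigma^{-k}\mathbb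 Z^n$, $Z_{\rm ext}=Z\times\prod_{\mathfrak p\mid(\alpha)}K_{\mathfrak p}$, $\Psi(\mathbf x)=(\mathbf x,\langle\mathbf x,\mathbf v_\alpha\rangle,\dots,\langle\mathbf x,\mathbf v_\alpha\rangle)\in Z_{\rm ext}$; $M_\sigma$ acts on $Z_{\rm ext}$ as $M_\sigma$ on $Z$ and as multiplication by $\alpha$ on each $K_{\mathfrak p}$. On $\Psi(Z)\times\mathcal A$: $E_1[\mathbf z,b]=\bigcup_{b\xrightarrow{p}a}\{[M_\sigma\mathbf z-\Psi(\mathbf P(p)),a]\}$ (union over edges starting at $b$), and $E_1^*[\mathbf z,a]^*=\bigcup_{b\xrightarrow{p}a}\{[M_\sigma^{-1}(\mathbf z+\Psi(\mathbf P(p))),b]^*\}$ (union over edges ending at $a$). $\mathbb H\subset\mathbb R^n$ is the hyperplane orthogonal to $\mathbf v_\alpha$, $\pi_{\mathbf u}:\mathbb R^n\to\mathbb H$ the projection along the right eigenvector $\mathbf u_\alpha$ of $M_\sigma$ for $\alpha$ ($\langle\mathbf u_\alpha,\mathbf v_\alpha\rangle=1$), $\mathbb H_{\rm ext}=\mathbb H\times\prod_{\mathfrak p\mid(\alpha)}K_{\mathfrak p}$, and $G:\mathbb H_{\rm ext}\to K_\sigma$ is $G(\mathbf x,\mathbf y)=\big((\sum_i x_i\tau_{\mathfrak p}(v_i))_{\mathfrak p\mid\infty,\mathfrak p\neq\mathfrak p_1},\mathbf y\big)$, with $\tau_{\mathfrak p}:K\to K_{\mathfrak p}$ the embedding. Matrix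 function systems act on $n$-tuples of sets by $(\boldsymbol\varTheta(\underline A))_a=\bigcup_{b}\bigcup_{g\in\varTheta_{ab}}g(A_b)$. Here $\varTheta_{ab}=\{x\mapsto\alpha x+\delta(p):b\xrightarrow{p}a\}$ and $\varTheta^\#_{ab}=\{x\mapsto\alpha^{-1}(x+\delta(p)):a\xrightarrow{p}b\}$ on $\mathbb R$, and $(\varTheta^\star)^\#_{ab}=\{z\mapsto\alpha^{-1}(z+\Phi'(\delta(p))):a\xrightarrow{p}b\}$ on $K_\sigma$. *)

(* Defs.v *)
From HB Require Import structures.
From mathcomp Require Import all_boot all_order all_algebra ring_quotient.
From mathcomp Require Import complex ring.
From mathcomp Require Import boolp classical_sets functions reals topology.
From mathcomp Require Import normedtype sequences exp.

Set Implicit Arguments.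
Unset Strict Implicit.
Unset Printing Implicit Defensive.

Import Order.TTheory GRing.Theory Num.Theory.
Local Open Scope ring_scope.
Local Open Scope classical_set_scope.
Local Open Scope complex_scope.

(** * Absolute values and completions *)

Record absval (R : realType) (F : fieldType) := AbsVal {
  av :> F -> R;
  av_ge0 : forall x, 0 <= av x;
  av_eq0 : forall x, (av x == 0) = (x == 0);
  av_mul : forall x y, av (x * y) = av x * av y;
  av_triangle : forall x y, av (x + y) <= av x + av y }.

Section Completion.
Variables (R : realType) (F : fieldType) (w : absval R F).
Implicit Types (u t : nat -> F).

Lemma av0 : w 0 = 0.
Proof. by apply/eqP; rewrite av_eq0. Qed.

Lemma av1 : w 1 = 1.
Proof.
have w1 : w 1 != 0 by rewrite av_eq0 oner_eq0.
by apply: (mulfI w1); rewrite -av_mul !mulr1.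
Qed.

Lemma avN x : w (- x) = w x.
Proof.
have h : w (-1) = 1.
  have /eqP : w (-1) ^+ 2 = 1 by rewrite expr2 -av_mul mulrNN mulr1 av1.
  by rewrite sqrp_eq1 ?av_ge0// => /eqP.
by rewrite -mulN1r av_mul h mul1r.
Qed.

Lemma av_sub x y : w (x - y) <= w x + w y.
Proof. by rewrite -[w y]avN av_triangle. Qed.

Lemma av_gt0 x : x != 0 -> 0 < w x.
Proof. by move=> x0; rewrite lt_neqAle eq_sym av_eq0 x0 av_ge0. Qed.

Lemma avV x : x != 0 -> w x^-1 = (w x)^-1.
Proof.
move=> x0; have wx : w x != 0 by rewrite av_eq0.
by apply: (mulfI wx); rewrite -av_mul !divff// av1.
Qed.

Definition av_cauchy u := forall e : R, 0 < e ->
  exists N, forall m n, (N <= m)%N -> (N <= n)%N -> w (u m - u n) < e.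

Definition av_null u := forall e : R, 0 < e ->
  exists N, forall n, (N <= n)%N -> w (u n) < e.

Lemma av_cauchy_bounded u : av_cauchy u ->
  exists2 B : R, 0 < B & exists N, forall n, (N <= n)%N -> w (u n) < B.
Proof.
move=> /(_ 1 ltr01)[N uN]; exists (1 + w (u N)).
  by rewrite ltr_pwDl ?av_ge0.
exists N => n Nn; rewrite -[u n](subrK (u N)).
by rewrite (le_lt_trans (av_triangle _ _ _))// ltrD2r uN.
Qed.

Definition cauchy_seq : pred (nat -> F) := [pred u | `[< av_cauchy u >]].

Lemma cauchy_seq_subring : subring_closed cauchy_seq.
Proof.
split.
- apply/asboolP => e e0; exists 0%N => m n _ _.
  have -> : (1 : nat -> F) m - (1 : nat -> F) n = 0 by exact: subrr.
  by rewrite av0.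
- move=> u t /asboolP uC /asboolP tC; apply/asboolP => e e0.
  have e2 : 0 < e / 2 by rewrite divr_gt0.
  have [N uN] := uC _ e2; have [M tM] := tC _ e2.
  exists (maxn N M) => m n; rewrite !geq_max => /andP[Nm Mm] /andP[Nn Mn].
  have -> : (u - t) m - (u - t) n = (u m - u n) - (t m - t n).
    by rewrite -[(u - t) m]/(u m - t m) -[(u - t) n]/(u n - t n); ring.
  by rewrite (le_lt_trans (av_sub _ _))// (splitr e) ltrD// ?uN ?tM.
- move=> u t /asboolP uC /asboolP tC; apply/asboolP => e e0.
  have e2 : 0 < e / 2 by rewrite divr_gt0.
  have [A A0 [N1 uA]] := av_cauchy_bounded uC.
  have [B B0 [N2 tB]] := av_cauchy_bounded tC.
  have [N3 uN] := uC (e / 2 / B) (divr_gt0 e2 B0).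
  have [N4 tN] := tC (e / 2 / A) (divr_gt0 e2 A0).
  exists (maxn (maxn N1 N2) (maxn N3 N4)) => m n; rewrite !geq_max.
  move=> /andP[/andP[m1 m2] /andP[m3 m4]] /andP[/andP[n1 n2] /andP[n3 n4]].
  have -> : (u * t) m - (u * t) n = u m * (t m - t n) + (u m - u n) * t n.
    by rewrite -[(u * t) m]/(u m * t m) -[(u * t) n]/(u n * t n); ring.
  rewrite (le_lt_trans (av_triangle _ _ _))// (splitr e) !av_mul ltrD//.
    have -> : e / 2 = A * (e / 2 / A) by rewrite [RHS]mulrC divfK// gt_eqF.
    by rewrite ltr_pM ?av_ge0 ?uA ?tN.
  have -> : e / 2 = (e / 2 / B) * B by rewrite [RHS]divfK// gt_eqF.
  by rewrite ltr_pM ?av_ge0 ?uN ?tB.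
Qed.

HB.instance Definition _ :=
  GRing.isSubringClosed.Build (nat -> F) cauchy_seq cauchy_seq_subring.

Record cauchyType := CauchySeq { cval :> nat -> F; _ : cauchy_seq cval }.
HB.instance Definition _ := [isSub for cval].
HB.instance Definition _ := [Choice of cauchyType by <:].
HB.instance Definition _ := [SubChoice_isSubComNzRing of cauchyType by <:].

Definition null_seq : pred cauchyType := [pred u | `[< av_null (cval u) >]].

Lemma null_seq_ideal : idealr_closed null_seq.
Proof.
split.
- by apply/asboolP => e e0; exists 0%N => n _; rewrite [X in w X](_ : _ = 0) ?av0.
- apply/negP => /asboolP /(_ 1 ltr01)[N /(_ N (leqnn N))].
  by rewrite [X in w X](_ : _ = 1) ?av1 ?ltxx.
- move=> a u t /asboolP u0 /asboolP t0; apply/asboolP => e e0.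
  have e2 : 0 < e / 2 by rewrite divr_gt0.
  have [A A0 [N1 aA]] := av_cauchy_bounded (asboolW (valP a)).
  have [N2 uN] := u0 (e / 2 / A) (divr_gt0 e2 A0).
  have [N3 tN] := t0 _ e2.
  exists (maxn N1 (maxn N2 N3)) => n; rewrite !geq_max => /and3P[n1 n2 n3].
  rewrite -[cval (a * u + t) n]/(cval a n * cval u n + cval t n).
  rewrite (le_lt_trans (av_triangle _ _ _))// (splitr e) !av_mul ltrD// ?tN//.
  have -> : e / 2 = A * (e / 2 / A) by rewrite [RHS]mulrC divfK// gt_eqF.
  by rewrite ltr_pM ?av_ge0 ?aA ?uN.
Qed.

HB.instance Definition _ := isIdealr.Build cauchyType null_seq null_seq_ideal.

Definition null_ideal : idealr cauchyType := null_seq.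
(* Cauchy sequences modulo null sequences. *)
Definition completion := {ideal_quot null_ideal}.
HB.instance Definition _ := GRing.ComNzRing.on completion.

Definition climit (a : cauchyType) : completion := (\pi a)%qT.

Lemma climit_zmod : zmod_morphism climit.
Proof. exact: (rmorphB (\pi_({ideal_quot null_ideal})%qT)). Qed.

Lemma climit_monoid : monoid_morphism climit.
Proof. exact: (conj (rmorph1 (\pi_({ideal_quot null_ideal})%qT))
  (rmorphM (\pi_({ideal_quot null_ideal})%qT))). Qed.

HB.instance Definition _ :=
  GRing.isZmodMorphism.Build cauchyType completion climit climit_zmod.
HB.instance Definition _ :=
  GRing.isMonoidMorphism.Build cauchyType completion climit climit_monoid.

Lemma climit_eq0 (a : cauchyType) : (climit a == 0) = null_seq a.
Proof.
rewrite -(rmorph0 climit) /climit.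
by rewrite -[null_seq a]/(a \in null_ideal) -[in RHS](subr0 a) (Quotient.idealrBE null_ideal).
Qed.

Lemma cauchy_seq_cst x : cauchy_seq (fun=> x).
Proof. by apply/asboolP => e e0; exists 0%N => m n _ _; rewrite subrr av0. Qed.

Definition completion_emb x : completion := climit (CauchySeq (cauchy_seq_cst x)).

Lemma completion_emb_zmod : zmod_morphism completion_emb.
Proof.
by move=> x y; rewrite /completion_emb -rmorphB; congr climit; apply: val_inj.
Qed.

Lemma completion_emb_monoid : monoid_morphism completion_emb.
Proof.
split=> [|x y]; rewrite /completion_emb -?(rmorph1 climit) -?rmorphM;
  by congr climit; apply: val_inj.
Qed.

HB.instance Definition _ :=
  GRing.isZmodMorphism.Build F completion completion_emb completion_emb_zmod.
HB.instance Definition _ :=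
  GRing.isMonoidMorphism.Build F completion completion_emb completion_emb_monoid.

Lemma completion_invP (x : completion) :
  exists y : completion, if x == 0 then y = 0 else y * x = 1.
Proof.
case: eqP => [_|/eqP]; first by exists 0.
have [u ->] : exists u : cauchyType, x = climit u.
  by exists (repr (x : {ideal_quot null_ideal})); rewrite /climit reprK.
rewrite climit_eq0 => /asboolPn u0.
have uC : av_cauchy u by exact: asboolW (valP u).
have [d d0 [N uN]] : exists2 d : R, 0 < d &
    exists N, forall n, (N <= n)%N -> d <= w (u n).
  have [e [e0 /forallNP ue]] : exists e : R, 0 < e /\
      ~ exists N, forall n, (N <= n)%N -> w (u n) < e.
    by apply: contrapT => /forallNP H; apply: u0 => e e0; apply: contrapT => h; apply: (H e).
  have e2 : 0 < e / 2 by rewrite divr_gt0.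
  exists (e / 2) => //; have [N uN] := uC _ e2; exists N => n Nn.
  rewrite leNgt; apply/negP => un; apply: (ue N) => m Nm.
  rewrite -[u m](subrK (u n)) (splitr e).
  by rewrite (le_lt_trans (av_triangle _ _ _))// ltrD// uN.
have un0 n : (N <= n)%N -> u n != 0.
  by move=> /uN; rewrite -(av_eq0 w) => /(lt_le_trans d0)/gt_eqF ->.
have tC : cauchy_seq (fun n => (u n)^-1).
  apply/asboolP => e e0.
  have [M uM] := uC (e * (d * d)) (mulr_gt0 e0 (mulr_gt0 d0 d0)).
  exists (maxn N M) => m n; rewrite !geq_max => /andP[Nm Mm] /andP[Nn Mn].
  have -> : (u m)^-1 - (u n)^-1 = (u n - u m) * ((u m)^-1 * (u n)^-1).
    by field; rewrite !un0.
  rewrite !av_mul !avV ?un0// -invfM.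
  rewrite ltr_pdivrMr ?mulr_gt0 ?av_gt0 ?un0//.
  rewrite (lt_le_trans (uM _ _ _ _))// ler_wpM2l ?(ltW e0)//.
  by rewrite ler_pM ?(ltW d0) ?uN.
exists (climit (CauchySeq tC)).
apply/eqP; rewrite -subr_eq0 -(rmorph1 climit) -rmorphM -rmorphB climit_eq0; apply/asboolP => e e0; exists N => n Nn.
rewrite [X in w X](_ : _ = (u n)^-1 * u n - 1)//.
by rewrite mulVf ?un0// subrr av0.
Qed.

Definition completion_inv (x : completion) : completion :=
  sval (cid (completion_invP x)).

Lemma completion_mulVf (x : completion) : x != 0 -> completion_inv x * x = 1.
Proof. by rewrite /completion_inv; case: cid => y /=; case: eqP. Qed.

Lemma completion_invr0 : completion_inv 0 = 0.
Proof. by rewrite /completion_inv; case: cid => y /=; rewrite eqxx. Qed.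

HB.instance Definition _ :=
  GRing.ComNzRing_isField.Build completion completion_mulVf completion_invr0.

End Completion.

(** * Places of a field *)

Section Places.
Variables (R : realType) (F : fieldType).

Definition nonarchimedean (w : absval R F) :=
  forall x y, w (x + y) <= Num.max (w x) (w y).

Definition nontrivial_absval (w : absval R F) := exists2 x, x != 0 & w x != 1.

Definition equiv_absval (w w' : absval R F) :=
  exists2 s : R, 0 < s & forall x, w' x = w x `^ s.

Definition is_finite_place (C : set (absval R F)) :=
  exists w, [/\ nonarchimedean w, nontrivial_absval w & C = equiv_absval w].

Definition finite_place := {C : set (absval R F) | is_finite_place C}.

(* A representative of the class; equivalent absolute values have the same
   Cauchy and null sequences, so the completion does not depend on it. *)
Definition finite_absval (p : finite_place) : absval R F :=
  sval (cid (svalP p)).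

(* The prime ideal of the ring of integers attached to a finite place. *)
Definition prime_ideal (p : finite_place) : set F :=
  [set x | integralOver (intr : int -> F) x /\ finite_absval p x < 1].

(* p | (x), i.e. the principal ideal (x) is contained in the prime ideal. *)
Definition divides (p : finite_place) (x : F) := prime_ideal p x.

(* A complex place is a pair of conjugate embeddings with non-real image. *)
Definition is_complex_place (C : set (F -> R[i])) :=
  exists t : {rmorphism F -> R[i]},
    (exists x, Im (t x) != 0) /\ C = [set (t : F -> R[i]); fun x => conjc (t x)].

Definition complex_place := {C : set (F -> R[i]) | is_complex_place C}.

(* One of the two conjugate embeddings, identifying K_p with R[i]. *)
Definition complex_place_emb (p : complex_place) : {rmorphism F -> R[i]} :=
  sval (cid (svalP p)).

(* Infinite places are embeddings into the complex numbers up to conjugation,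
   with completion R or C; finite places are classes of nonarchimedean absolute
   values. *)
Inductive place :=
| RealPlace of {rmorphism F -> R}
| ComplexPlace of complex_place
| FinitePlace of finite_place.

Definition Kp (p : place) : fieldType :=
  match p with
  | RealPlace _ => R
  | ComplexPlace _ => R[i]
  | FinitePlace q => completion (finite_absval q)
  end.

Definition tau (p : place) : {rmorphism F -> Kp p} :=
  match p as q return {rmorphism F -> Kp q} with
  | RealPlace t => t
  | ComplexPlace q => complex_place_emb q
  | FinitePlace q => @completion_emb R F (finite_absval q)
  end.

End Places.

(** * The field Q(alpha) *)

Section QAdjoin.
Variables (R : realType) (alpha : R).

Definition inQadj : pred R := [pred x | `[< exists p q : {poly rat},
  x = (map_poly ratr p).[alpha] / (map_poly ratr q).[alpha] >]].

Lemma inQadj_divring : divring_closed inQadj.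
Proof.
split.
- by apply/asboolP; exists 1, 1; rewrite !rmorph1 !hornerE ?divr1 ?mulr1 ?invr1.
- move=> x y /asboolP[p [q ->]] /asboolP[p' [q' ->]]; apply/asboolP.
  have [q0|q0] := eqVneq (map_poly ratr q).[alpha] 0.
    by exists (- p'), q'; rewrite rmorphN hornerN q0 invr0 mulr0 sub0r mulNr.
  have [q0'|q0'] := eqVneq (map_poly ratr q').[alpha] 0.
    by exists p, q; rewrite q0' invr0 mulr0 subr0.
  exists (p * q' - p' * q), (q * q').
  by rewrite rmorphB !rmorphM hornerD hornerN !hornerM /=; field; rewrite q0 q0'.
- move=> x y /asboolP[p [q ->]] /asboolP[p' [q' ->]]; apply/asboolP.
  exists (p * q'), (q * p'); rewrite !rmorphM /= !hornerM !invfM invrK mulrACA.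
  by rewrite -!mulrA; congr (_ * _); rewrite mulrA mulrC [_ / _]mulrC.
Qed.

HB.instance Definition _ := GRing.isDivringClosed.Build R inQadj inQadj_divring.

Record Qadj := MkQadj { qval : R; _ : inQadj qval }.
HB.instance Definition _ := [isSub for qval].
HB.instance Definition _ := [Choice of Qadj by <:].
HB.instance Definition _ := [SubChoice_isSubIntegralDomain of Qadj by <:].
HB.instance Definition _ := [SubIntegralDomain_isSubField of Qadj by <:].

Lemma inQadj_gen : inQadj alpha.
Proof.
by apply/asboolP; exists 'X, 1; rewrite map_polyX rmorph1 !hornerE ?divr1 ?mulr1 ?invr1.
Qed.

Definition alphaK : Qadj := MkQadj inQadj_gen.

End QAdjoin.

(** * Irreducible Pisot substitutions *)

Section Pisot.
Variable R : realType.
Implicit Types (alpha : R) (z : R[i]).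

(* z is a root of the minimal polynomial of alpha over Q. *)
Definition conjugate alpha z := exists p : {poly rat},
  [/\ p \is monic, irreducible_poly p, root (map_poly ratr p) alpha
    & root (map_poly ratr p) z].

Definition Pisot_number alpha :=
  [/\ integralOver (intr : int -> R) alpha, 1 < alpha
    & forall z, conjugate alpha z -> z != alpha%:C -> `|z| < 1].

Definition dominant_eigenvalue n (M : 'M[rat]_n) alpha :=
  eigenvalue (map_mx (ratr : rat -> R) M) alpha /\
  forall z, eigenvalue (map_mx ratr M) z -> z != alpha%:C -> `|z| < alpha%:C.

End Pisot.

Section Substitution.
(* A substitution is given by the images of the letters. *)
Variables (n : nat) (sigma : 'I_n -> seq 'I_n).

Definition subst_word (w : seq 'I_n) : seq 'I_n := flatten (map sigma w).

Definition is_substitution :=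
  (forall b, sigma b <> [::]) /\
  exists b, size (iter k subst_word [:: b]) @[k --> \oo] --> \oo.

Definition parikh (w : seq 'I_n) : 'cV[rat]_n := \col_a (count_mem a w)%:R.

Definition incidence : 'M[rat]_n := \matrix_(a, b) (count_mem a (sigma b))%:R.

Definition primitive_mx (M : 'M[rat]_n) :=
  exists2 k, (0 < k)%N & forall a b, 0 < (M ^+ k) a b.

Definition irreducible_Pisot (R : realType) (alpha : R) :=
  [/\ is_substitution, primitive_mx incidence,
      irreducible_poly (char_poly incidence),
      dominant_eigenvalue incidence alpha & Pisot_number alpha].

(* The edge b --p--> a of the prefix automaton. *)
Definition edge (b : 'I_n) (p : seq 'I_n) (a : 'I_n) :=
  exists s, sigma b = p ++ a :: s.

Definition Zlat : set 'cV[rat]_n :=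
  [set x | exists k (y : 'cV[int]_n),
    x = invmx incidence ^+ k *m map_mx intr y].

End Substitution.

(** * Tuples of sets and matrix function systems *)

Section MFS.
Variables (n : nat) (T : Type).

Definition tuple_of_sets := 'I_n -> set T.

Definition mfs (Th : 'I_n -> 'I_n -> set (T -> T)) (A : tuple_of_sets) :
    tuple_of_sets :=
  fun a => \bigcup_b \bigcup_(g in Th a b) (g @` A b).

Definition vmap (xa : T * 'I_n) : tuple_of_sets :=
  fun b => if b == xa.2 then [set xa.1] else set0.

Definition ext_sets (S : Type) (phi : S -> tuple_of_sets) (A : set S) :
    tuple_of_sets :=
  fun a => \bigcup_(s in A) phi s a.

(* The square with vertices D and the n-tuples of subsets of T, with sides
   the multivalued map E on D, phi and Th: E stays in D, and
   phi o E = Th o phi at every point of D. *)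
Definition square_commutes (S : Type) (D : set S) (E : S -> set S)
    (phi : S -> tuple_of_sets) (Th : tuple_of_sets -> tuple_of_sets) :=
  forall s, D s -> E s `<=` D /\ ext_sets phi (E s) = Th (phi s).

End MFS.

(** * Representation space and the dual maps *)

Section Pisot_maps.
Variables (R : realType) (n : nat) (sigma : 'I_n -> seq 'I_n) (alpha : R).
Variables (v : 'rV[Qadj alpha]_n) (u : 'cV[R]_n).

Local Notation K := (Qadj alpha).
Local Notation alphaK := (alphaK alpha).
Local Notation M := (incidence sigma).
Local Notation edge := (edge sigma).

Definition left_eigenvector :=
  v *m map_mx ratr M = alphaK *: v /\ forall i, 0 < val (v 0 i).

Definition right_eigenvector :=
  map_mx ratr M *m u = alpha *: u /\ \sum_i u i 0 * val (v 0 i) = 1.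

Definition pairing (x : 'cV[rat]_n) : K := \sum_i ratr (x i 0) * v 0 i.

Definition delta (w : seq 'I_n) : K := pairing (parikh w).

(* The prime p_1 is the one given by the inclusion of K in R. *)
Definition p1 : place R K := RealPlace (\val : {rmorphism K -> R}).

Definition S_alpha : set (place R K) :=
  [set p | if p is FinitePlace q then divides q alphaK else True].

Definition S_alpha' := {p : place R K | S_alpha p /\ p <> p1}.

Definition K_sigma := forall p : S_alpha', Kp (sval p).

Definition Phi' (x : K) : K_sigma := fun p => tau (sval p) x.

Definition K_act (x : K) (z : K_sigma) : K_sigma := fun p => tau (sval p) x * z p.

Definition K_add (z z' : K_sigma) : K_sigma := fun p => z p + z' p.

Definition fin_alpha := {q : finite_place R K | divides q alphaK}.

Definition K_fin := forall q : fin_alpha, Kp (FinitePlace (sval q)).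

(* Z_ext is the subset of Q^n * K_fin with first component in Zlat. *)
Definition Q_ext := ('cV[rat]_n * K_fin)%type.

Definition Psi (x : 'cV[rat]_n) : Q_ext :=
  (x, fun q => tau (FinitePlace (sval q)) (pairing x)).

Definition ext_add (z z' : Q_ext) : Q_ext :=
  (z.1 + z'.1, fun q => z.2 q + z'.2 q).

Definition ext_sub (z z' : Q_ext) : Q_ext :=
  (z.1 - z'.1, fun q => z.2 q - z'.2 q).

Definition M_ext (z : Q_ext) : Q_ext :=
  (M *m z.1, fun q => tau (FinitePlace (sval q)) alphaK * z.2 q).

Definition M_ext_inv (z : Q_ext) : Q_ext :=
  (invmx M *m z.1, fun q => (tau (FinitePlace (sval q)) alphaK)^-1 * z.2 q).

Definition Psi_Z_A : set (Q_ext * 'I_n) :=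
  [set za | (Psi @` Zlat sigma) za.1].

Definition E1 (za : Q_ext * 'I_n) : set (Q_ext * 'I_n) :=
  [set yb | exists p a, edge za.2 p a /\
    yb = (ext_sub (M_ext za.1) (Psi (parikh p)), a)].

(* The formal star on [z, a]^* is dropped. *)
Definition E1star (za : Q_ext * 'I_n) : set (Q_ext * 'I_n) :=
  [set yb | exists p b, edge b p za.2 /\
    yb = (M_ext_inv (ext_add za.1 (Psi (parikh p))), b)].

(* Empty unless za.1 = Psi y with y in Zlat: the map h is defined on Psi(Z) only. *)
Definition hmap (za : Q_ext * 'I_n) : tuple_of_sets n R := fun b =>
  if b == za.2
  then [set x | exists2 y, Zlat sigma y /\ Psi y = za.1 & x = val (pairing (- y))]
  else set0.

Definition Xdom : set (R * 'I_n) :=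
  [set xa | 0 <= xa.1 < val (delta [:: xa.2])].

Definition Tinv (xa : R * 'I_n) : set (R * 'I_n) :=
  [set yb | exists p b, edge b p xa.2 /\
    yb = (alpha^-1 * (xa.1 + val (delta p)), b)].

(* The projection onto the hyperplane orthogonal to v, along u. *)
Definition pi_u (x : 'cV[R]_n) : 'cV[R]_n :=
  x - (\sum_i x i 0 * val (v 0 i)) *: u.

Lemma pi_uP (x : 'cV[R]_n) : right_eigenvector ->
  \sum_i pi_u x i 0 * val (v 0 i) = 0 /\ exists c, x = pi_u x + c *: u.
Proof.
move=> [_ uv]; split; last by exists (\sum_i x i 0 * val (v 0 i)); rewrite /pi_u subrK.
under eq_bigr do rewrite !mxE mulrBl -mulrA.
by rewrite sumrB -mulr_sumr uv mulr1 subrr.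
Qed.

Definition pi_u_ext (z : Q_ext) : 'cV[R]_n * K_fin :=
  (pi_u (map_mx ratr z.1), z.2).

Definition Gmap (xy : 'cV[R]_n * K_fin) : K_sigma := fun p =>
  (match sval p as q return S_alpha q /\ q <> p1 -> Kp q with
   | RealPlace t => fun _ => \sum_i xy.1 i 0 * t (v 0 i)
   | ComplexPlace t => fun _ =>
       \sum_i (xy.1 i 0)%:C * complex_place_emb t (v 0 i)
   | FinitePlace q => fun H => xy.2 (exist _ q (proj1 H))
   end) (svalP p).

Definition Cmap (za : Q_ext * 'I_n) : tuple_of_sets n K_sigma :=
  vmap (Gmap (pi_u_ext za.1), za.2).

Definition Theta (a b : 'I_n) : set (R -> R) :=
  [set g | exists2 p, edge b p a & g = fun x => alpha * x + val (delta p)].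

Definition Theta_sharp (a b : 'I_n) : set (R -> R) :=
  [set g | exists2 p, edge a p b & g = fun x => alpha^-1 * (x + val (delta p))].

Definition Theta_star_sharp (a b : 'I_n) : set (K_sigma -> K_sigma) :=
  [set g | exists2 p, edge a p b &
    g = fun z => K_act alphaK^-1 (K_add z (Phi' (delta p)))].

End Pisot_maps.

(* Main.v *)
(** [Psi], [delta] and the pairing with [v] intertwine [M] with the
    multiplication by [alpha], which gives the first two squares.  For the third
    one, the point is that [x |-> G ((pi_u x id) (Psi x))] is [x |-> Phi' <x, v>]:
    at an infinite place [t] other than [p1], [t v] is a left eigenvector of [M]
    for [t alpha], and [t alpha <> alpha] because [alpha] generates [K]; hence
    [t v] is orthogonal to [u], and projecting along [u] does not change the
    coordinate at [t]. *)
Require Import Defs.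
From mathcomp Require Import all_boot all_order all_algebra.
From mathcomp Require Import complex.
From mathcomp Require Import boolp classical_sets reals.

Set Implicit Arguments.
Unset Strict Implicit.
Unset Printing Implicit Defensive.

Import Order.TTheory GRing.Theory Num.Theory.
Local Open Scope ring_scope.
Local Open Scope classical_set_scope.
Local Open Scope complex_scope.

(** * Field morphisms out of $\mathbb Q(\alpha)$ *)

Lemma rmorphism_ext (A B : nzRingType) (f g : {rmorphism A -> B}) :
  f =1 g -> f = g.
Proof.
case: f => f [[f1] [f2]]; case: g => g [[g1] [g2]] /= /funext fg.
case: _ / fg in g1 g2 *.
by rewrite (Prop_irrelevance f1 g1) (Prop_irrelevance f2 g2).
Qed.

Lemma horner_map_ratr (A B : fieldType) (f : {rmorphism A -> B})
    (p : {poly rat}) (x : A) :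
  f (map_poly ratr p).[x] = (map_poly ratr p).[f x].
Proof.
rewrite -horner_map -map_poly_comp; congr horner.
by apply: eq_map_poly => q /=; rewrite fmorph_rat.
Qed.

Lemma map_ratr_mx (A B : fieldType) (f : {rmorphism A -> B}) (m n : nat)
    (M : 'M[rat]_(m, n)) :
  map_mx f (map_mx ratr M) = map_mx ratr M.
Proof. by apply/matrixP => i j; rewrite !mxE fmorph_rat. Qed.

(** Every element of $K$ is a quotient of rational polynomials in $\alpha$, so a morphism on $K$ is
    determined by its value at [alphaK alpha]. *)
Lemma Qadj_rmorphism_eq (R : realType) (alpha : R) (L : fieldType)
    (t : {rmorphism Qadj alpha -> L}) (j : {rmorphism R -> L}) :
  t (alphaK alpha) = j alpha -> forall x, t x = j (val x).
Proof.
move=> tj x; have [p [q xE]] := asboolW (valP x).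
have valE (r : {poly rat}) :
    val (map_poly ratr r).[alphaK alpha] = (map_poly ratr r).[alpha].
  exact: (horner_map_ratr (val : {rmorphism Qadj alpha -> R})).
have -> : x = (map_poly ratr p).[alphaK alpha] / (map_poly ratr q).[alphaK alpha].
  by apply: val_inj; rewrite xE -!valE; apply/esym/fmorph_div.
by rewrite !fmorph_div /= !horner_map_ratr tj -!(horner_map_ratr j) -!valE.
Qed.

(** * Parikh vectors, the incidence matrix and the module $Z$ *)

Section Words.
Context {n : nat} (sigma : 'I_n -> seq 'I_n).

Lemma parikh_cat (w w' : seq 'I_n) : parikh (w ++ w') = parikh w + parikh w'.
Proof. by apply/colP => a; rewrite !mxE count_cat natrD. Qed.

Lemma parikh_subst b : parikh (sigma b) = incidence sigma *m parikh [:: b].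
Proof.
apply/colP => a; rewrite !mxE (bigD1 b)//= big1 => [|c cb].
  by rewrite !mxE /= eqxx mulr1 addr0.
by rewrite !mxE /= eq_sym (negPf cb) mulr0.
Qed.

Lemma incidence_mulmx_int (y : 'cV[int]_n) : exists z : 'cV[int]_n,
  incidence sigma *m map_mx intr y = map_mx intr z.
Proof.
exists ((\matrix_(a, b) (count_mem a (sigma b))%:Z) *m y).
by rewrite map_mxM; congr (_ *m _); apply/matrixP => a b; rewrite !mxE.
Qed.

(** If the determinant vanished, $X$ would divide the irreducible characteristic polynomial, hence
    be associate to it; its root $\alpha$ would then be $0$, against $\alpha>1$. *)
Lemma incidence_unitmx (R : realType) (alpha : R) :
  irreducible_Pisot sigma alpha -> incidence sigma \in unitmx.
Proof.
move=> [_ _ irr [eig _] [_ alpha1 _]].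
rewrite unitmxE unitfE; apply/negP => /eqP det0.
have X_dvd : 'X %| char_poly (incidence sigma).
  rewrite -['X]subr0 -polyC0 dvdp_XsubCl; apply/rootP.
  by rewrite horner_coef0 char_poly_det det0 mulr0.
have /eqp_dvdr XE : 'X %= char_poly (incidence sigma).
  by apply: (apply_irredp irr) => //; rewrite size_polyX.
move: eig; rewrite eigenvalue_root_char -map_char_poly -dvdp_XsubCl.
have : char_poly (incidence sigma) %| 'X by rewrite XE dvdpp.
rewrite -(dvdp_map (ratr : {rmorphism rat -> R})) map_polyX => cX.
move=> /dvdp_trans/(_ cX); rewrite dvdp_XsubCl rootX => /eqP alpha0.
by move: alpha1; rewrite alpha0 ltr10.
Qed.

Hypothesis Munit : incidence sigma \in unitmx.

(** Since $M$ preserves $\mathbb Z^n$, the sets $M^{-k}\mathbb Z^n$ increase with $k$. Two elements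
    of $Z$ thus share an exponent, which gives closure under addition. *)
Lemma Zlat_exp x : Zlat sigma x -> exists k0, forall k, (k0 <= k)%N ->
  exists y : 'cV[int]_n, x = invmx (incidence sigma) ^+ k *m map_mx intr y.
Proof.
case=> k0 [y0 ->]; exists k0 => k /subnKC <-.
elim: (k - k0)%N => [|d [y yE]]; first by exists y0; rewrite addn0.
have [z zE] := incidence_mulmx_int y; exists z.
by rewrite addnS exprSr -mulmxE -mulmxA -zE mulKmx.
Qed.

Lemma Zlat_int (y : 'cV[int]_n) : Zlat sigma (map_mx intr y).
Proof. by exists 0%N, y; rewrite expr0 mul1mx. Qed.

Lemma Zlat_parikh w : Zlat sigma (parikh w).
Proof.
have -> : parikh w = map_mx intr (\col_a (count_mem a w)%:Z).
  by apply/colP => a; rewrite !mxE.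
exact: Zlat_int.
Qed.

Lemma Zlat_opp x : Zlat sigma x -> Zlat sigma (- x).
Proof. by case=> k [y ->]; exists k, (- y); rewrite map_mxN mulmxN. Qed.

Lemma Zlat_add x y : Zlat sigma x -> Zlat sigma y -> Zlat sigma (x + y).
Proof.
move=> /Zlat_exp[k xk] /Zlat_exp[l yl].
have [[x' ->] [y' ->]] := (xk _ (leq_maxl k l), yl _ (leq_maxr k l)).
by exists (maxn k l), (x' + y'); rewrite map_mxD mulmxDr.
Qed.

Lemma Zlat_mulM x : Zlat sigma x -> Zlat sigma (incidence sigma *m x).
Proof.
(* A representation with exponent $k+1$ is chosen so that one factor $M^{-1}$ is always there to
   cancel. *)
move=> /Zlat_exp[k /(_ _ (leqnSn k))[y ->]]; exists k, y.
by rewrite exprS -mulmxE -mulmxA mulKVmx.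
Qed.

Lemma Zlat_mulV x : Zlat sigma x -> Zlat sigma (invmx (incidence sigma) *m x).
Proof. by case=> k [y ->]; exists k.+1, y; rewrite exprS -mulmxE mulmxA. Qed.

End Words.

(** * The pairing with $\mathbf v_\alpha$ turns $M$ into multiplication by $\alpha$ *)

Section Pairing.
Context {R : realType} {n : nat} {alpha : R} (v : 'rV[Qadj alpha]_n).

Lemma rmorph_pairing {L : fieldType} (t : {rmorphism Qadj alpha -> L})
    (x : 'cV[rat]_n) : t (pairing v x) = (map_mx t v *m map_mx ratr x) 0 0.
Proof.
rewrite /pairing rmorph_sum !mxE; apply: eq_bigr => i _.
by rewrite rmorphM fmorph_rat !mxE mulrC.
Qed.

(* [Qadj alpha] is only a [fieldType], for which [ratr] is not known to be a
   morphism: identities in it are obtained through the injection in [R]. *)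
Let valK : {rmorphism Qadj alpha -> R} := val.

Lemma pairingD (x y : 'cV[rat]_n) : pairing v (x + y) = pairing v x + pairing v y.
Proof.
apply: val_inj; rewrite [RHS](rmorphD valK) -[LHS]/(valK _) !rmorph_pairing.
by rewrite map_mxD mulmxDr mxE.
Qed.

Lemma pairingN (x : 'cV[rat]_n) : pairing v (- x) = - pairing v x.
Proof.
apply: val_inj; rewrite [RHS](rmorphN valK) -[LHS]/(valK _) !rmorph_pairing.
by rewrite map_mxN mulmxN mxE.
Qed.

Lemma delta_cat w w' : delta v (w ++ w') = delta v w + delta v w'.
Proof. by rewrite /delta parikh_cat pairingD. Qed.

Lemma delta_cons a w : delta v (a :: w) = delta v [:: a] + delta v w.
Proof. exact: (delta_cat [:: a]). Qed.

Lemma PsiD x y : Psi v (x + y) = ext_add (Psi v x) (Psi v y).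
Proof. by congr pair; apply: functional_extensionality_dep => q; rewrite pairingD rmorphD. Qed.

Lemma PsiB x y : Psi v (x - y) = ext_sub (Psi v x) (Psi v y).
Proof. by congr pair; apply: functional_extensionality_dep => q; rewrite pairingD pairingN rmorphB. Qed.

Context {sigma : 'I_n -> seq 'I_n}.
Hypothesis left_v : left_eigenvector sigma v.

(** The entries of $M$ are rational, hence fixed by [t], so the eigenvector equation can be
    conjugated. *)
Lemma rmorph_left_eigenvector {L : fieldType}
    (t : {rmorphism Qadj alpha -> L}) :
  map_mx t v *m map_mx ratr (incidence sigma) = t (alphaK alpha) *: map_mx t v.
Proof.
have [vM _] := left_v.
by rewrite -(map_ratr_mx t) -map_mxM vM map_mxZ.
Qed.

Lemma pairing_mulM x :
  pairing v (incidence sigma *m x) = alphaK alpha * pairing v x.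
Proof.
apply: val_inj; rewrite [RHS](rmorphM valK) -[LHS]/(valK _) !rmorph_pairing.
by rewrite map_mxM mulmxA (rmorph_left_eigenvector valK) -scalemxAl mxE.
Qed.

Lemma delta_subst b : delta v (sigma b) = alphaK alpha * delta v [:: b].
Proof. by rewrite /delta parikh_subst pairing_mulM. Qed.

Lemma delta_ge0 w : 0 <= val (delta v w).
Proof.
have [_ v_gt0] := left_v.
rewrite -[val _]/(valK _) rmorph_pairing mxE sumr_ge0 // => i _.
by rewrite !mxE ratr_nat mulr_ge0 ?ler0n //; apply: ltW (v_gt0 i).
Qed.

Lemma Psi_mulM x : Psi v (incidence sigma *m x) = M_ext sigma (Psi v x).
Proof. by congr pair; apply: functional_extensionality_dep => q; rewrite pairing_mulM rmorphM. Qed.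

Hypotheses (Munit : incidence sigma \in unitmx) (alpha_neq0 : alpha != 0).

Lemma alphaK_neq0 : alphaK alpha != 0.
Proof. by apply: contra alpha_neq0 => /eqP/(congr1 val)/= ->. Qed.

Lemma pairing_mulV x :
  pairing v (invmx (incidence sigma) *m x) = (alphaK alpha)^-1 * pairing v x.
Proof.
apply: (mulfI alphaK_neq0).
by rewrite -pairing_mulM mulKVmx // mulVKf // alphaK_neq0.
Qed.

Lemma Psi_mulV x :
  Psi v (invmx (incidence sigma) *m x) = M_ext_inv sigma (Psi v x).
Proof.
by congr pair; apply: functional_extensionality_dep => q; rewrite pairing_mulV rmorphM fmorphV.
Qed.

End Pairing.

(** * Orthogonality of conjugate eigenvectors and the projection along $\mathbf u_\alpha$ *)

Section Projection.
Context {R : realType} {n : nat} {sigma : 'I_n -> seq 'I_n} {alpha : R}.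
Context {v : 'rV[Qadj alpha]_n} {u : 'cV[R]_n}.
Hypotheses (left_v : left_eigenvector sigma v)
           (right_u : right_eigenvector sigma v u).

(** Evaluating $t(\mathbf v)\,M\,j(\mathbf u)$ from the left and from the right multiplies the same
    product by $t(\alpha)$ and by $j(\alpha)$. Here [j] will be the identity of $\mathbb R$ or its
    inclusion in $\mathbb C$. *)
Lemma conj_eigenvectors_orthogonal {L : fieldType}
    (t : {rmorphism Qadj alpha -> L}) (j : {rmorphism R -> L}) :
  t (alphaK alpha) <> j alpha -> map_mx t v *m map_mx j u = 0.
Proof.
move=> tj; have [Mu _] := right_u.
have := rmorph_left_eigenvector left_v t.
move=> /(congr1 (fun w => w *m map_mx j u)); rewrite -mulmxA.
rewrite -(map_ratr_mx j) -map_mxM Mu map_mxZ -scalemxAl -scalemxAr.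
move=> /eqP; rewrite eq_sym -subr_eq0 -scalerBl scaler_eq0 subr_eq0.
by case/orP => /eqP.
Qed.

Lemma conj_pairing_pi_u {L : fieldType}
    (t : {rmorphism Qadj alpha -> L}) (j : {rmorphism R -> L}) x :
  t (alphaK alpha) <> j alpha ->
  \sum_i j (pi_u v u (map_mx ratr x) i 0) * t (v 0 i) = t (pairing v x).
Proof.
move=> tj; transitivity ((map_mx t v *m map_mx j (pi_u v u (map_mx ratr x))) 0 0).
  by rewrite mxE; apply: eq_bigr => i _; rewrite mulrC !mxE.
rewrite /pi_u map_mxB map_mxZ mulmxBr -scalemxAr conj_eigenvectors_orthogonal //.
by rewrite scaler0 subr0 map_ratr_mx rmorph_pairing.
Qed.

Lemma Gmap_pi_u_ext_Psi x :
  Gmap v (pi_u_ext v u (Psi v x)) = Phi' (pairing v x).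
Proof.
apply: functional_extensionality_dep => -[[t|t|q] [Sq p1_neq]] //=.
(* At finite places both sides agree by computation. A real place sending $\alpha$ to itself would
   be $\mathfrak p_1$, which is excluded. *)
- rewrite /Gmap /Phi' /=; apply: (conj_pairing_pi_u (j := idfun)) => tE.
  apply: p1_neq; congr RealPlace; apply: rmorphism_ext => y.
  exact: (Qadj_rmorphism_eq (j := idfun)).
- rewrite /Gmap /Phi' /=.
  apply: (conj_pairing_pi_u (j := real_complex R)) => tE.
  (* A complex place sending $\alpha$ to itself would take only real values, but its embedding has a
     non-real one. *)
  have := Qadj_rmorphism_eq tE.
  rewrite /complex_place_emb; case: cid => s [[y Im_y] _] /= /(_ y) sy.
  by move: Im_y; rewrite sy -complexIm /= eqxx.
Qed.

End Projection.

(** * Matrix function systems on singletons, and the three squares *)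

Section Squares.
Context {n : nat} {T : Type}.

Lemma mfs_vmap (Th : 'I_n -> 'I_n -> set (T -> T)) x b a :
  mfs Th (vmap (x, b)) a = [set g x | g in Th a b].
Proof.
apply/seteqP; split=> [y [c _ [g Thg [z]]]|y [g Thg <-]].
  by rewrite /vmap /=; case: eqP => // cb -> <-; exists g; rewrite // -cb.
by exists b => //; exists g => //; exists x; rewrite /vmap /= ?eqxx.
Qed.

(* Each of the three multivalued maps sends [s] to the image of a set of labelled
   edges [I], and the matrix function system sends [phi s] along the same edges. *)
Lemma square_commutesP (S : Type) (D : set S) (E : S -> set S)
    (phi : S -> tuple_of_sets n T) (Th : 'I_n -> 'I_n -> set (T -> T)) :
  (forall s, D s -> exists I (P : set (I * 'I_n)) (e : I -> 'I_n -> S)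
     (f : I -> T) x b, [/\ phi s = vmap (x, b),
     E s = [set e i.1 i.2 | i in P],
     forall i a, P (i, a) -> D (e i a) /\ phi (e i a) = vmap (f i, a)
   & forall a, [set g x | g in Th a b] = [set f i | i in [set i | P (i, a)]]]) ->
  square_commutes D E phi (mfs Th).
Proof.
move=> H s Ds; have [I [P [e [f [x [b [-> -> Pe ThE]]]]]]] := H s Ds; split.
  by move=> _ [[i a] Pia <-]; have [] := Pe i a Pia.
apply/funext => a; rewrite mfs_vmap ThE; apply/seteqP; split => y.
  case=> _ [[i c] Pic <-] /=; have [_ ->] := Pe i c Pic.
  by rewrite /vmap /=; case: eqP => // -> ->; exists i.
case=> i Pia <-; exists (e i a); first by exists (i, a).
by have [_ ->] := Pe i a Pia; rewrite /vmap /= eqxx.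
Qed.

End Squares.

Lemma hmap_Psi (R : realType) (n : nat) (sigma : 'I_n -> seq 'I_n) (alpha : R)
    (v : 'rV[Qadj alpha]_n) y b : Zlat sigma y ->
  hmap sigma v (Psi v y, b) = vmap (val (pairing v (- y)), b).
Proof.
move=> Zy; apply/funext => c; rewrite /hmap /vmap /=; case: eqP => // _.
apply/seteqP; split => [x [z [_ zy] ->]|x ->]; last by exists y.
(* [Psi] is injective: its first component is the vector itself. *)
by move: (congr1 fst zy) => /= ->.
Qed.

Theorem lemma7p6 (R : realType) (n : nat) (sigma : 'I_n -> seq 'I_n)
    (alpha : R) (v : 'rV[Qadj alpha]_n) (u : 'cV[R]_n) :
  irreducible_Pisot sigma alpha ->
  left_eigenvector sigma v ->
  right_eigenvector sigma v u ->
  [/\ square_commutes (Psi_Z_A sigma v) (E1 sigma v) (hmap sigma v)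
        (mfs (Theta sigma v)),
      square_commutes (Xdom v) (Tinv sigma v) (@vmap n R)
        (mfs (Theta_sharp sigma v))
    & square_commutes (Psi_Z_A sigma v) (E1star sigma v) (Cmap v u)
        (mfs (Theta_star_sharp sigma v))].
Proof.
move=> Pisot left_v right_u; have Munit := incidence_unitmx Pisot.
have alpha_gt0 : 0 < alpha by case: Pisot => _ _ _ _ [_ /(lt_trans ltr01)].
have alpha_neq0 := lt0r_neq0 alpha_gt0.
split; apply: square_commutesP.
- move=> [_ b] [y Zy /= <-].
  exists (seq 'I_n), [set pa | edge sigma b pa.1 pa.2].
  exists (fun p a => (Psi v (incidence sigma *m y - parikh p), a)).
  exists (fun p => alpha * val (pairing v (- y)) + val (delta v p)).
  exists (val (pairing v (- y))), b; split.
  + exact: hmap_Psi.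
  + apply/seteqP; split => [_ [p [a [bpa ->]]]|_ [[p a] bpa <-]].
      by exists (p, a); rewrite //= PsiB Psi_mulM.
    by exists p, a; rewrite /= PsiB Psi_mulM.
  + move=> p a _; have Zp : Zlat sigma (incidence sigma *m y - parikh p).
      by apply: Zlat_add (Zlat_mulM _ Zy) (Zlat_opp (Zlat_parikh _ _)).
    split; first by eexists; [exact: Zp|].
    (* $\langle -(My-\mathbf P(p)),\mathbf v\rangle=\alpha\langle -y,\mathbf v\rangle+\delta(p)$. *)
    by rewrite hmap_Psi // opprB addrC pairingD -mulmxN pairing_mulM //.
  + move=> a; apply/seteqP; split => [_ [_ [p bpa ->] <-]|_ [p bpa <-]].
      by exists p.
    by eexists; [exists p|].
- move=> [x a] /= /andP[x_ge0 x_lt].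
  exists (seq 'I_n), [set pb | edge sigma pb.2 pb.1 a].
  exists (fun p b => (alpha^-1 * (x + val (delta v p)), b)).
  exists (fun p => alpha^-1 * (x + val (delta v p))), x, a; split=> //.
  + apply/seteqP; split => [_ [p [b [bpa ->]]]|_ [[p b] bpa <-]].
      by exists (p, b).
    by exists p, b.
  + move=> p b [s bpas]; split=> //; rewrite /Xdom /=; apply/andP; split.
      by rewrite mulr_ge0 ?addr_ge0 ?(delta_ge0 left_v) // invr_ge0 ltW.
    (* From $\sigma(b)=pas$, $\alpha\delta(b)=\delta(p)+\delta(a)+\delta(s)$; as $x<\delta(a)$ and
       $\delta(s)\ge0$, the new point lies below $\delta(b)$. *)
    have /(congr1 val) := delta_subst left_v b; rewrite bpas delta_cat delta_cons.
    rewrite /= => deltaE; rewrite ltr_pdivrMl // -deltaE [x + _]addrC ltrD2l.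
    by rewrite ltr_wpDr // (delta_ge0 left_v).
  + move=> b; apply/seteqP; split => [_ [_ [p bpa ->] <-]|_ [p bpa <-]].
      by exists p.
    by eexists; [exists p|].
- move=> [_ a] [y Zy /= <-].
  exists (seq 'I_n), [set pb | edge sigma pb.2 pb.1 a].
  exists (fun p b => (Psi v (invmx (incidence sigma) *m (y + parikh p)), b)).
  exists (fun p => Phi' ((alphaK alpha)^-1 * pairing v (y + parikh p))).
  exists (Phi' (pairing v y)), a; split.
  + by rewrite /Cmap /= (Gmap_pi_u_ext_Psi left_v right_u).
  + apply/seteqP; split => [_ [p [b [bpa ->]]]|_ [[p b] bpa <-]].
      by exists (p, b); rewrite //= Psi_mulV // PsiD.
    by exists p, b; rewrite /= Psi_mulV // PsiD.
  + move=> p b _; split.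
      by eexists; [exact: Zlat_mulV (Zlat_add _ Zy (Zlat_parikh _ _))|].
    by rewrite /Cmap /= (Gmap_pi_u_ext_Psi left_v right_u) (pairing_mulV left_v).
  (* All points involved lie in the image of [Phi'], which is a morphism in each coordinate, so the
     action reduces to arithmetic in $K$. *)
  + have actE p : K_act (alphaK alpha)^-1
        (K_add (Phi' (pairing v y)) (Phi' (delta v p))) =
      Phi' ((alphaK alpha)^-1 * pairing v (y + parikh p)).
      apply: functional_extensionality_dep => q.
      by rewrite /K_act /K_add /Phi' rmorphM pairingD rmorphD.
    move=> b; apply/seteqP; split => [_ [_ [p bpa ->] <-]|_ [p bpa <-]].
      by exists p.
    by eexists; [exists p|].
Qed.
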